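(* Let $n\geq 1$ and assume that every polyhedra system of dimension at most $n-1$ has a reduction of singularities. Then for every $n$-dimensional special polyhedra system $\mathcal D$ there is a finite sequence of characteristic transforms $\mathcal D\rightarrow\cdots\rightarrow\mathcal D'$ (each centered in a stratum of the singular locus of the system being transformed) such that $\mathcal D'$ is consistent.
   Context: Support fabrics. For a finite set $I$, $\mathcal P(I)$ denotes its power set, with the Zariski topology: $\mathcal K\subset\mathcal P(I)$ is closed iff $J_1\in\mathcal K$, $J_2\supset J_1$ imply $J_2\in\mathcal K$; equivalently $\mathcal H$ is open iff $J\in\mathcal H$ implies $\mathcal P(J)\subset\mathcal H$. A support fabric is a pair $\mathcal F=(I,\mathcal H)$ with $I$ finite and $\mathcal H\subset\mathcal P(I)$ open; $\mathcal H$ has the subspace topology. Elements of $\mathcal H$ are called strata. $\dim\mathcal F=\max\{\#J:J\in\mathcal H\}$. Blow-up. Let $J\in\mathcal H$ be non-empty. Put $I'=I\cup\{\infty\}$ with $\infty\notin I$. Let $\mathcal H'_s=\{K\in\mathcal H: J\not\subset K\}$; for $K\in\mathcal H$ with $K\supset J$ let $\mathcal H'^K_\infty=\{(K\setminus J)\cup A\cup\{\infty\}: A\subsetneq J\}$; let $\mathcal H'_\infty=\bigcup_{K\in\mathcal H,K\supset J}\mathcal H'^K_\infty$ and $\mathcal H'=\mathcal H'_s\cup\mathcal H'_\infty$. The blow-up is the support fabric $\pi_J(\mathcal F)=(I',\mathcal H')$. The map $\pi_J^\#:\mathcal H'\to\mathcal H$ is defined by $\pi_J^\#(J')=J'$ if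 $J'\in\mathcal H'_s$ and $\pi_J^\#(J')=K$ if $J'\in\mathcal H'^K_\infty$. Polyhedra systems. For a finite set $J$ and $A\subset\mathbb R^J_{\ge0}$, let $[[A]]$ be the convex hull of $A+\mathbb R^J_{\ge0}$. For an integer $d\ge1$, a characteristic polyhedron with denominator $d$ is a set $\Delta=[[A]]\subset\mathbb R^J_{\ge0}$ with $A\subset\frac1d\mathbb Z^J_{\ge0}$; all polyhedra are assumed non-empty. A polyhedra system with denominator $d$ is $\mathcal D=(\mathcal F;\{\Delta_J\}_{J\in\mathcal H},d)$, where $\mathcal F=(I,\mathcal H)$ is a support fabric, each $\Delta_J\subset\mathbb R^J_{\ge0}$ is a characteristic polyhedron with denominator $d$, and $\Delta_{J_1}=\mathrm{pr}_{J_2,J_1}(\Delta_{J_2})$ whenever $J_1\subset J_2$ are in $\mathcal H$, with $\mathrm{pr}_{J_2,J_1}(\sigma)=\sigma|_{J_1}$. Its dimension is $\dim\mathcal F$. Singular locus. For $\Delta\subset\mathbb R^J_{\ge0}$ with $J\neq\emptyset$, $\delta(\Delta)=\min\{|\sigma|:\sigma\in\Delta\}$ with $|\sigma|=\sum_{j\in J}\sigma(j)$; for $J=\emptyset$ the convention is $\delta(\Delta)=-1$. $\delta(\mathcal D)=\max_{J\in\mathcal H}\delta(\Delta_J)$. $\mathrm{Sing}(\mathcal D)=\{J\in\mathcal H:\delta(\Delta_J)\ge1\}$, a closed subset of $\mathcal H$. $\mathcal D$ is singular if $\mathrm{Sing}(\mathcal D)\ne\emptyset$, non-singular otherwise, and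 special if $\delta(\mathcal D)=1$. Characteristic transform. For $J\in\mathrm{Sing}(\mathcal D)$, $J'\in\mathcal H'_\infty$ and $K=\pi_J^\#(J')$, define $\lambda_{J'}:\mathbb R^K\to\mathbb R^{J'}$ by $\lambda_{J'}(\sigma)(j)=\sigma(j)$ for $j\ne\infty$ and $\lambda_{J'}(\sigma)(\infty)=\sum_{j\in J}\sigma(j)$. The characteristic transform of $\mathcal D$ centered in $J$ is the polyhedra system $\Lambda_J(\mathcal D)=(\pi_J(\mathcal F);\{\Delta'_{J'}\}_{J'\in\mathcal H'},d)$ with $\Delta'_{J'}=\Delta_{J'}$ if $J'\in\mathcal H'_s$, and $\Delta'_{J'}=[[\lambda_{J'}(\Delta_K)]]-e_{J',\infty}$ if $J'\in\mathcal H'_\infty$, $K=\pi_J^\#(J')$, where $e_{J',\infty}\in\mathbb R^{J'}$ is the standard basis vector of index $\infty$. A reduction of singularities of $\mathcal D$ is a finite sequence (possibly of length zero) of characteristic transforms, each centered in a singular stratum, starting at $\mathcal D$ and ending at a system with empty singular locus. Consistency. For $\Delta\subset\mathbb R^J_{\ge0}$ with $\delta(\Delta)=1$, the strict tangent space is $T(\Delta)=\{j\in J:\exists\sigma\in\Delta,\ |\sigma|=1,\ \sigma(j)\ne0\}$. For a closed subset $\mathcal K\subset\mathcal H$, let $\mathcal H_{\mathcal K}=\bigcup_{J\in\mathcal K}\mathcal P(J)$ and $\mathrm{Red}_{\mathcal K}(\mathcal D)=((I,\mathcal H_{\mathcal K});\{\Delta_J\}_{J\in\mathcal H_{\mathcal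 K}},d)$. A non-empty stratum $T$ of a special system $\mathcal D$ has maximal contact with $\mathcal D$ if $T\subset T(\Delta_J)$ for all $J\in\mathrm{Sing}(\mathcal D)$. A special system $\mathcal D$ is consistent if for each connected component $\mathcal C_\alpha$ of $\mathrm{Sing}(\mathcal D)$ (subspace topology) there is a non-empty stratum $T_\alpha$ having maximal contact with $\mathrm{Red}_{\mathcal C_\alpha}(\mathcal D)$; by convention, non-singular polyhedra systems are consistent. *)

(* Defs.v *)
From HB Require Import structures.
From mathcomp Require Import all_boot all_order all_algebra.
From mathcomp Require Import boolp classical_sets reals topology convex interval_inference.

Set Implicit Arguments.
Unset Strict Implicit.
Unset Printing Implicit Defensive.

Import Order.TTheory GRing.Theory Num.Theory.

Local Open Scope classical_set_scope.
Local Open Scope ring_scope.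

(* The Zariski topology; {set I} carries it globally from here on, so open,
   closed and connected_component on sets of strata refer to it. *)
Section PowerSetTopology.
Variable I : finType.

Definition zariski_open : set_system {set I} :=
  [set H | forall J K : {set I}, H J -> K \subset J -> H K].

Lemma zariski_openT : zariski_open setT.
Proof. by []. Qed.

Lemma zariski_openI : setI_closed zariski_open.
Proof. by move=> A B hA hB J K [AJ BJ] KJ; split; [apply: hA AJ _|apply: hB BJ _]. Qed.

Lemma zariski_open_bigU (T : Type) (f : T -> set {set I}) :
  (forall i, zariski_open (f i)) -> zariski_open (\bigcup_i f i).
Proof. by move=> hf J K [i _ fJ] KJ; exists i => //; apply: hf fJ KJ. Qed.

HB.instance Definition _ := isOpenTopological.Build {set I}
  zariski_openT zariski_openI zariski_open_bigU.

Lemma zariski_openE (H : set {set I}) :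
  open H <-> forall J K : {set I}, H J -> K \subset J -> H K.
Proof. by []. Qed.

Lemma zariski_closedE (H : set {set I}) :
  closed H <-> forall J K : {set I}, H J -> J \subset K -> H K.
Proof.
rewrite -openC zariski_openE; split=> [h J K HJ JK|h J K nHJ KJ HK].
  by apply: contrapT => nHK; apply: (h K J nHK JK).
by apply: nHJ; apply: h HK KJ.
Qed.

End PowerSetTopology.

(* For J \subset I, R^J is encoded as the subspace of R^I of the vectors that
   vanish outside J, so restrictions and inclusions live in a single space. *)
Notation vec R I := {ffun I -> R^o}.

Section Polyhedra.
Variables (R : realType) (I : finType).
Implicit Types (J K : {set I}) (s : vec R I) (A D : set (vec R I)).

Definition orthant J : set (vec R I) :=
  [set s | (forall i, 0 <= s i) /\ (forall i, i \notin J -> s i = 0)].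

Definition restr J s : vec R I := [ffun i => if i \in J then s i else 0].

Definition convex_hull A : set (vec R I) :=
  smallest (@convex_set R (vec R I)) A.

(* [[A]] in R^J *)
Definition newton J A : set (vec R I) :=
  convex_hull [set a + b | a in A & b in orthant J].

Definition lattice (d : nat) J : set (vec R I) :=
  [set s | orthant J s /\ forall i, exists m : nat, s i = m%:R / d%:R].

Definition char_polyhedron (d : nat) J D : Prop :=
  D !=set0 /\ exists2 A, A `<=` lattice d J & D = newton J A.

Definition weight J s : R := \sum_(j in J) s j.

(* The least element of E, or the junk value 0 if there is none; deltaP shows
   that it is attained for characteristic polyhedra. *)
Definition minimum (E : set R) : R := xget 0 (E `&` lbound E).

Definition delta J D : R :=
  if J == finset.set0 then -1 else minimum [set weight J s | s in D].

Definition tangent J D : {set I} :=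
  [set j in J | `[< exists s, [/\ D s, weight J s = 1 & s j <> 0] >]]%SET.

End Polyhedra.

Arguments restr {R I} J s.

Section PolyhedraTheory.
Variable R : realType.

Lemma convexP (I : finType) (C : set (vec R I)) :
  convex_set (C : set (convex_lmodType (vec R I))) <->
  forall x y (t : R), 0 <= t -> t <= 1 -> C x -> C y -> C (t *: x + (1 - t) *: y).
Proof.
split=> [cC x y t t0 t1 Cx Cy|cC x y t].
  by have := cC x y (Itv01 t0 t1); rewrite !inE => /(_ Cx Cy).
rewrite !inE => Cx Cy; apply: cC => //.
Qed.

Lemma newton_sub (I : finType) (J : {set I}) (A : set (vec R I)) :
  A `<=` newton J A.
Proof.
move=> a Aa; apply: sub_gen_smallest; exists a => //; exists 0 => //.
  by split=> [i|i _]; rewrite ffunE.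
by rewrite addr0.
Qed.

Lemma newton_min (I : finType) (J : {set I}) (A C : set (vec R I)) :
  convex_set (C : set (convex_lmodType (vec R I))) ->
  (forall a b, A a -> orthant J b -> C (a + b)) -> newton J A `<=` C.
Proof.
move=> cC h; apply: smallest_sub => // _ [a Aa [b Jb <-]]; exact: h.
Qed.

Lemma newton_convex (I : finType) (J : {set I}) (A : set (vec R I)) :
  convex_set (newton J A : set (convex_lmodType (vec R I))).
Proof.
apply/convexP => x y t t0 t1 hx hy C [cC AC].
move/convexP: (cC); apply=> //; [exact: hx|exact: hy].
Qed.

Lemma newton_orthant (I : finType) (J : {set I}) (A : set (vec R I)) x b :
  newton J A x -> orthant J b -> newton J A (x + b).
Proof.
move=> Ax Jb; move: x Ax; apply: newton_min.
  apply/convexP => x y t t0 t1 hx hy /=.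
  have -> : t *: x + (1 - t) *: y + b = t *: (x + b) + (1 - t) *: (y + b).
    rewrite !scalerDr addrACA -scalerDl.
    by rewrite (_ : t + (1 - t) = 1) ?scale1r// addrC subrK.
  by move/convexP: (@newton_convex I J A); apply.
move=> a c Aa [c0 cJ]; case: Jb => b0 bJ.
apply: sub_gen_smallest; exists a => //; exists (c + b); last by rewrite addrA.
split=> [i|i iJ]; rewrite ffunE; first by rewrite addr_ge0.
by rewrite cJ// bJ// addr0.
Qed.

Lemma newton_ge0 (I : finType) (d : nat) (J : {set I}) (A : set (vec R I)) :
  A `<=` lattice d J -> newton J A `<=` orthant J.
Proof.
move=> AL; apply: newton_min.
  apply/convexP => x y t t0 t1 [x0 xJ] [y0 yJ]; split=> [i|i iJ]; rewrite !ffunE.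
    by rewrite addr_ge0// mulr_ge0// ?x0 ?y0// subr_ge0.
  by rewrite xJ// yJ// !scaler0 addr0.
move=> a b /AL[[a0 aJ] _] [b0 bJ]; split=> [i|i iJ]; rewrite ffunE.
  by rewrite addr_ge0.
by rewrite aJ// bJ// addr0.
Qed.

(* f is affine with linear part g *)
Definition affine (I I' : finType) (f g : vec R I -> vec R I') :=
  (forall x y t, f (t *: x + (1 - t) *: y) = t *: f x + (1 - t) *: f y) /\
  (forall x y, f (x + y) = f x + g y).

Lemma affine_preimage_convex (I I' : finType) f g (C : set (vec R I')) :
  @affine I I' f g -> convex_set (C : set (convex_lmodType (vec R I'))) ->
  convex_set ([set x | C (f x)] : set (convex_lmodType (vec R I))).
Proof.
move=> [fa _] /convexP cC; apply/convexP => x y t t0 t1 /= hx hy.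
by rewrite fa; apply: cC.
Qed.

Lemma newton_affine (I I' : finType) J J' (f g : vec R I -> vec R I') A :
  affine f g -> (forall b, orthant J b -> orthant J' (g b)) ->
  newton J' (f @` newton J A) = newton J' (f @` A).
Proof.
move=> fg gJ; apply/seteqP; split.
  apply: newton_min; first exact: newton_convex.
  move=> _ b [x Ax <-] Jb; apply: newton_orthant => //.
  move: x Ax; apply: newton_min.
    by apply: (affine_preimage_convex fg); exact: newton_convex.
  move=> a c Aa Jc /=; rewrite fg.2; apply: newton_orthant; last exact: gJ.
  by apply: newton_sub; exists a.
apply: newton_min; first exact: newton_convex.
move=> _ b [a Aa <-] Jb; apply: newton_orthant => //.
by apply: newton_sub; exists a => //; exact: newton_sub.
Qed.

Lemma newton_affine_onto (I I' : finType) J J' (f g : vec R I -> vec R I') A :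
  affine f g -> (forall b, orthant J b -> orthant J' (g b)) ->
  (forall c, orthant J' c -> exists2 b, orthant J b & g b = c) ->
  f @` newton J A = newton J' (f @` A).
Proof.
move=> fg gJ gonto; apply/seteqP; split.
  move=> _ [x Ax <-]; rewrite -(newton_affine A fg gJ).
  by apply: newton_sub; exists x.
apply: newton_min.
  apply/convexP => _ _ t t0 t1 [x Ax <-] [y Ay <-].
  exists (t *: x + (1 - t) *: y); last by rewrite fg.1.
  by move/convexP: (@newton_convex I J A); apply.
move=> _ c [a Aa <-] /gonto[b Jb <-].
exists (a + b); last by rewrite fg.2.
by apply: newton_orthant => //; exact: newton_sub.
Qed.

Lemma newton_idem (I : finType) (J : {set I}) (A : set (vec R I)) :
  newton J (newton J A) = newton J A.
Proof.
have := @newton_affine I I J J id id A; rewrite !image_id; apply=> //.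
Qed.

Lemma linear_affine (I I' : finType) (f : vec R I -> vec R I') :
  (forall x y (t u : R), f (t *: x + u *: y) = t *: f x + u *: f y) -> affine f f.
Proof.
move=> hf; split=> [x y t|x y]; first exact: hf.
by have := hf x y 1 1; rewrite !scale1r.
Qed.

Lemma restr_affine (I : finType) (J : {set I}) :
  affine (@restr R I J) (@restr R I J).
Proof.
apply: linear_affine => x y t u; apply/ffunP => i; rewrite !ffunE.
by case: ifP => // _; rewrite !scaler0 addr0.
Qed.

Lemma restr_orthant (I : finType) (J K : {set I}) (b : vec R I) :
  orthant J b -> orthant K (restr K b).
Proof.
by move=> [b0 _]; split=> [i|i iK]; rewrite ffunE; [case: ifP|rewrite (negbTE iK)].
Qed.

Lemma orthantS (I : finType) (J K : {set I}) :
  J \subset K -> @orthant R I J `<=` orthant K.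
Proof.
move=> JK b [b0 bJ]; split=> // i iK; apply: bJ.
by apply: contra iK; exact: (fintype.subsetP JK).
Qed.

Lemma restr_id (I : finType) (J : {set I}) (b : vec R I) :
  orthant J b -> restr J b = b.
Proof. by move=> [_ bJ]; apply/ffunP => i; rewrite ffunE; case: ifPn => // /bJ. Qed.

Lemma restr_newton (I : finType) (J K : {set I}) (A : set (vec R I)) :
  J \subset K -> restr J @` newton K A = newton J (restr J @` A).
Proof.
move=> JK; apply: newton_affine_onto.
- exact: restr_affine.
- by move=> b; exact: restr_orthant.
- move=> c Jc; exists c; [exact: orthantS Jc|exact: restr_id].
Qed.

Lemma translate_newton (I : finType) (J : {set I}) (e : vec R I) A :
  [set x - e | x in newton J A] = newton J [set x - e | x in A].
Proof.
apply: (@newton_affine_onto I I J J (fun x => x - e) id) => //; last first.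
  by move=> c Jc; exists c.
split=> [x y t|x y]; last by rewrite addrAC.
rewrite !scalerBr addrACA -opprD -scalerDl.
by rewrite (_ : t + (1 - t) = 1) ?scale1r// addrC subrK.
Qed.

Lemma weight_affine (I : finType) (J : {set I}) (x y : vec R I) (t u : R) :
  weight J (t *: x + u *: y) = t * weight J x + u * weight J y.
Proof.
by rewrite /weight !mulr_sumr -big_split/=; apply: eq_bigr => i _; rewrite !ffunE.
Qed.

Lemma lattice_weight (I : finType) (d : nat) (J K : {set I}) (a : vec R I) :
  lattice d K a -> exists m : nat, weight J a = m%:R / d%:R.
Proof.
move=> [_ /choice[m hm]]; exists (\sum_(j in J) m j)%N.
by rewrite natr_sum mulr_suml; apply: eq_bigr.
Qed.

Lemma weight_minimum (I : finType) (d : nat) (J : {set I}) (D : set (vec R I)) :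
  (0 < d)%N -> char_polyhedron d J D ->
  exists2 s, D s & forall r, D r -> weight J s <= weight J r.
Proof.
move=> d0 [[x Dx] [A AL DE]].
have [a0 Aa0] : A !=set0.
  apply: contrapT => nA; suff : newton J A `<=` set0 by rewrite -DE => /(_ x Dx).
  by apply: newton_min => [|a b Aa]; [apply/convexP|case: nA; exists a].
pose P (m : nat) := `[< exists2 a, A a & weight J a = m%:R / d%:R >].
have exP : exists m, P m.
  have [m hm] := lattice_weight J (AL _ Aa0).
  by exists m; apply/asboolP; exists a0.
case: (ex_minnP exP) => m /asboolP[a Aa am] mmin.
exists a; first by rewrite DE; exact: newton_sub.
rewrite DE; apply: newton_min.
  apply/convexP => u v t t0 t1 /= hu hv; rewrite weight_affine.
  rewrite -[leLHS]mul1r -{1}[1](subrKC t) mulrDl.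
  by rewrite lerD// ler_wpM2l// subr_ge0.
move=> u v Au [v0 _] /=.
have -> : weight J (u + v) = weight J u + weight J v.
  by have := weight_affine J u v 1 1; rewrite !scale1r !mul1r.
apply: (@le_trans _ _ (weight J u)); last by rewrite lerDl sumr_ge0.
have [k hk] := lattice_weight J (AL _ Au).
rewrite am hk ler_pM2r ?invr_gt0 ?ltr0n// ler_nat.
by apply: mmin; apply/asboolP; exists u.
Qed.

Lemma deltaP (I : finType) (d : nat) (J : {set I}) (D : set (vec R I)) :
  (0 < d)%N -> char_polyhedron d J D -> J != finset.set0 ->
  (exists2 s, D s & weight J s = delta J D) /\
  (forall s, D s -> delta J D <= weight J s).
Proof.
move=> d0 /(weight_minimum d0)[s Ds smin] J0.
rewrite /delta (negbTE J0) /minimum.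
have : ([set weight J s | s in D] `&` lbound [set weight J s | s in D]) (weight J s).
  by split; [exists s|move=> _ [r Dr <-]; exact: smin].
move=> /(xgetI 0)[[r Dr <-] rmin].
by split=> [|u Du]; [exists r|apply: rmin; exists u].
Qed.

End PolyhedraTheory.

(* Openness of strata is closure under subsets (zariski_openE). *)
Record support_fabric := SupportFabric {
  ground : finType;
  strata : set {set ground};
  strata_open : open strata }.

Arguments strata : clear implicits.

Definition fabric_dim (F : support_fabric) : nat :=
  \max_(J : {set ground F} | J \in strata F) #|J|.

(* The values of polyhedron outside the strata are irrelevant. *)
Record polyhedra_system (R : realType) := PolyhedraSystem {
  fabric :> support_fabric;
  denom : nat;
  polyhedron : {set ground fabric} -> set (vec R (ground fabric));
  denom_gt0 : (0 < denom)%N;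
  polyhedronP : forall J, strata fabric J ->
    char_polyhedron denom J (polyhedron J);
  polyhedron_restr : forall J1 J2 : {set ground fabric},
    strata fabric J1 -> strata fabric J2 -> J1 \subset J2 ->
    polyhedron J1 = restr J1 @` polyhedron J2 }.

Arguments polyhedron {R} p J.

Section SingularLocus.
Variables (R : realType) (D : polyhedra_system R).

(* -1 is delta at the empty stratum and a lower bound of all the values, so it
   only acts as a default when there are no strata at all. *)
Definition delta_system : R :=
  \big[Num.max/-1]_(J : {set ground D} | J \in strata D)
    delta J (polyhedron D J).

Definition Sing : set {set ground D} :=
  [set J | strata D J /\ 1 <= delta J (polyhedron D J)].

Definition singular : Prop := Sing !=set0.

Definition special : Prop := delta_system = 1.

Lemma Sing_strata : Sing `<=` strata D.
Proof. by move=> J []. Qed.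

Lemma Sing_weight J K (s : vec R (ground D)) :
  Sing J -> strata D K -> J \subset K -> polyhedron D K s -> 1 <= weight J s.
Proof.
move=> [HJ dJ] HK JK Ks.
have J0 : J != finset.set0.
  by apply: contraTneq dJ => ->; rewrite /delta eqxx -ltNge gtrN.
have [_ /(_ (restr J s))] := deltaP (denom_gt0 D) (polyhedronP HJ) J0.
rewrite (polyhedron_restr HJ HK JK) => /(_ (ex_intro2 _ _ s Ks erefl)).
have -> : weight J (restr J s) = weight J s.
  by apply: eq_bigr => j jJ; rewrite ffunE jJ.
by apply: le_trans; rewrite -(polyhedron_restr HJ HK JK).
Qed.

End SingularLocus.
Arguments Sing {R} D.

(* Blow-up: I' = option I, the new index infinity being None and J' \subset I
   being identified with Some @: J'. *)
Section BlowUp.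
Variables (I : finType) (H : set {set I}) (J : {set I}).

Definition blowup_old : set {set option I} :=
  [set Some @: K | K in [set K : {set I} | H K /\ ~ (J \subset K)]].

Definition blowup_new_over (K : {set I}) : set {set option I} :=
  [set None |: Some @: ((K :\: J) :|: A) | A in [set A : {set I} | A \proper J]].

Definition blowup_new : set {set option I} :=
  \bigcup_(K in [set K : {set I} | H K /\ J \subset K]) blowup_new_over K.

Definition blowup_strata : set {set option I} := blowup_old `|` blowup_new.

(* pi_J^#, with values in H: blowup_map_old and blowup_map_new show that it
   sends Some @: K to K and every element of blowup_new_over K to K. *)
Definition blowup_map (J' : {set option I}) : {set I} :=
  if None \in J' then J :|: Some @^-1: J' else Some @^-1: J'.

Lemma preim_Some_imset (K : {set I}) : Some @^-1: (Some @: K) = K.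
Proof. by apply/setP => i; rewrite inE mem_imset//; exact: Some_inj. Qed.

Lemma None_imset (K : {set I}) : (None \in Some @: K) = false.
Proof. by apply/negP => /imsetP[]. Qed.

Lemma imset_preim_Some (J' : {set option I}) :
  None \notin J' -> Some @: (Some @^-1: J') = J'.
Proof.
move=> nJ'; apply/setP => -[i|]; last by rewrite None_imset (negbTE nJ').
by rewrite mem_imset ?inE//; exact: Some_inj.
Qed.

Lemma blowup_map_old (K : {set I}) : blowup_map (Some @: K) = K.
Proof. by rewrite /blowup_map None_imset preim_Some_imset. Qed.

Lemma blowup_map_new (K : {set I}) (J' : {set option I}) :
  J \subset K -> blowup_new_over K J' -> blowup_map J' = K.
Proof.
move=> JK [A /= AJ <-]; rewrite /blowup_map !inE eqxx/=; apply/setP => i.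
rewrite !inE/= mem_imset; last exact: Some_inj.
rewrite !inE; case: (boolP (i \in J)) => /= [/(fintype.subsetP JK) -> //|iJ].
case: (boolP (i \in A)) => [/(fintype.subsetP (proper_sub AJ))|_]; last by rewrite orbF.
by rewrite (negbTE iJ).
Qed.

Lemma blowup_newP J' : blowup_new J' <->
  [/\ H (blowup_map J'), None \in J' & ~ (J \subset Some @^-1: J')].
Proof.
split.
  move=> [K [HK JK] hJ']; rewrite (blowup_map_new JK hJ').
  case: hJ' => A /= AJ <-; split=> //; first by rewrite !inE.
  move=> JA; move/properP: AJ => [AJ [i iJ iA]].
  have := fintype.subsetP JA _ iJ; rewrite !inE/= mem_imset; last exact: Some_inj.
  by rewrite !inE iJ (negbTE iA).
rewrite /blowup_map; move=> [HK nJ' nJ]; rewrite nJ' in HK.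
exists (J :|: Some @^-1: J'); first by split=> //; exact: finset.subsetUl.
exists (J :&: Some @^-1: J') => /=.
  rewrite properE finset.subsetIl/=; apply/negP => h; apply: nJ.
  exact: fintype.subset_trans h (finset.subsetIr _ _).
apply/setP => -[i|]; last by rewrite !inE nJ'.
rewrite !inE/= mem_imset; last exact: Some_inj.
by rewrite !inE; case: (i \in J); rewrite ?orbF.
Qed.

Lemma blowup_oldP J' : blowup_old J' <->
  [/\ H (Some @^-1: J'), None \notin J' & ~ (J \subset Some @^-1: J')].
Proof.
split=> [[K [HK JK] <-]|[HK nJ' JK]].
  by rewrite preim_Some_imset None_imset.
by exists (Some @^-1: J'); rewrite ?imset_preim_Some.
Qed.

Lemma blowup_open : open H -> open blowup_strata.
Proof.
move=> /zariski_openE oH; apply/zariski_openE => J1 J2 h J21.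
have sub : Some @^-1: J2 \subset Some @^-1: J1.
  by apply/fintype.subsetP => i; rewrite !inE; exact: (fintype.subsetP J21).
have nsub : ~ (J \subset Some @^-1: J1) -> ~ (J \subset Some @^-1: J2).
  by move=> + J2s; apply; exact: fintype.subset_trans J2s sub.
case: h => [/blowup_oldP[H1 n1 s1]|/blowup_newP[H1 n1 s1]].
  left; apply/blowup_oldP; split; [exact: oH H1 sub| |exact: nsub].
  by apply: contra n1; exact: (fintype.subsetP J21).
rewrite /blowup_map n1 in H1.
case: (boolP (None \in J2)) => n2; [right|left].
  apply/blowup_newP; split; [|by []|exact: nsub].
  by rewrite /blowup_map n2; apply: oH H1 _; exact: finset.setUS.
apply/blowup_oldP; split; [|by []|exact: nsub].
exact: oH H1 (fintype.subset_trans sub (finset.subsetUr _ _)).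
Qed.

End BlowUp.

(* Meaningful when J is a non-empty stratum, as in char_transform. *)
Definition blowup (F : support_fabric) (J : {set ground F}) : support_fabric :=
  SupportFabric (@blowup_open _ _ J (@strata_open F)).

Section CharacteristicTransform.
Variables (R : realType) (I : finType).

(* The inclusion of R^K into R^(Some @: K). *)
Definition extend0 (s : vec R I) : vec R (option I) :=
  [ffun o => if o is Some i then s i else 0].

Definition lambda (J : {set I}) (J' : {set option I}) (s : vec R I) :
    vec R (option I) :=
  [ffun o => if o \in J' then
    (if o is Some i then s i else \sum_(j in J) s j) else 0].

Definition e_inf : vec R (option I) :=
  [ffun o => if o is Some _ then 0 else 1].

(* On the strata of the blow-up, None \in J' holds exactly on blowup_new
   (blowup_newP, blowup_oldP). *)
Definition transform_polyhedron (D : {set I} -> set (vec R I)) (J : {set I})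
    (J' : {set option I}) : set (vec R (option I)) :=
  let K := blowup_map J J' in
  if None \in J'
  then [set s - e_inf | s in newton J' (lambda J J' @` D K)]
  else extend0 @` D K.

Lemma extend0_affine : affine extend0 extend0.
Proof.
apply: linear_affine => x y t u; apply/ffunP => -[i|]; rewrite !ffunE//.
by rewrite !scaler0 addr0.
Qed.

Lemma lambda_affine J J' : affine (lambda J J') (lambda J J').
Proof.
apply: linear_affine => x y t u; apply/ffunP => o; rewrite !ffunE.
case: ifP => _; last by rewrite !scaler0 addr0.
by case: o => [i|]; [rewrite !ffunE|exact: weight_affine].
Qed.

Lemma lambda_orthant J J' K b : orthant K b -> orthant J' (lambda J J' b).
Proof.
move=> [b0 _]; split=> [o|o oJ']; rewrite ffunE; last by rewrite (negbTE oJ').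
by case: ifP => // _; case: o => // ; rewrite sumr_ge0.
Qed.

Lemma extend0_newton (J' : {set option I}) A : None \notin J' ->
  extend0 @` newton (Some @^-1: J') A = newton J' (extend0 @` A).
Proof.
move=> nJ'; apply: newton_affine_onto; first exact: extend0_affine.
  move=> b [b0 bJ]; split=> [[i|]|[i|]]; rewrite ffunE// => iJ'.
  by apply: bJ; rewrite inE.
move=> c [c0 cJ]; exists [ffun i => c (Some i)].
  by split=> [i|i]; rewrite ffunE// inE => /cJ.
by apply/ffunP => -[i|]; rewrite !ffunE// cJ.
Qed.

End CharacteristicTransform.

Arguments lambda {R I} J J' s.

Section CharTransformSystem.
Variables (R : realType) (D : polyhedra_system R) (J : {set ground D}).
Hypothesis SJ : Sing D J.

Let P' := transform_polyhedron (polyhedron D) J.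

Lemma transform_polyhedronP J' : strata (blowup J) J' ->
  char_polyhedron (denom D) J' (P' J').
Proof.
have d0 : (denom D)%:R != 0 :> R by rewrite pnatr_eq0 -lt0n denom_gt0.
rewrite /P' /transform_polyhedron; case=> [/blowup_oldP|/blowup_newP] [HK n _].
  rewrite (negbTE n) /blowup_map (negbTE n).
  have [[x Dx] [A AL DE]] := polyhedronP HK; split; first by exists (extend0 x); exists x.
  exists (@extend0 R _ @` A); last by rewrite DE extend0_newton.
  move=> _ [a /AL[[a0 aJ] aL] <-]; split.
    by split=> [[i|]|[i|]]; rewrite ffunE// => iJ'; apply: aJ; rewrite inE.
  by case=> [i|]; rewrite ffunE; [exact: aL|exists 0%N; rewrite mul0r].
rewrite n.
have JK : J \subset blowup_map J J' by rewrite /blowup_map n finset.subsetUl.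
have [[x Dx] [A AL DE]] := polyhedronP HK; split.
  exists (lambda J J' x - e_inf R (ground D)); exists (lambda J J' x) => //.
  by apply: newton_sub; exists x.
exists [set s - e_inf R _ | s in lambda J J' @` A]; last first.
  rewrite {1}DE (newton_affine A (lambda_affine R J J')) ?translate_newton//.
  by move=> b; exact: lambda_orthant.
move=> _ [_ [a Aa <-] <-].
have w1 : 1 <= weight J a.
  by apply: (Sing_weight SJ HK JK); rewrite DE; exact: newton_sub.
have [m hm] := lattice_weight J (AL _ Aa).
have [[a0 aJ] aL] := AL _ Aa.
split; first split=> [[i|]|[i|]].
- by rewrite !ffunE subr0; case: ifP.
- by rewrite !ffunE n subr_ge0.
- by move=> iJ'; rewrite !ffunE (negbTE iJ') subr0.
- by rewrite n.
case=> [i|]; rewrite !ffunE.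
  rewrite subr0; case: ifP => _; first exact: aL.
  by exists 0%N; rewrite mul0r.
rewrite n -/(weight J a); exists (m - denom D)%N.
rewrite natrB ?mulrBl ?divff// ?hm//.
by rewrite -(ler_nat R) -(mul1r (denom D)%:R) -ler_pdivlMr ?ltr0n ?denom_gt0// -hm.
Qed.

Lemma transform_polyhedron_restr (J1 J2 : {set ground (blowup J)}) :
  strata (blowup J) J1 -> strata (blowup J) J2 -> J1 \subset J2 ->
  P' J1 = restr J1 @` P' J2.
Proof.
move=> S1 S2 J12; have := transform_polyhedronP S1.
have sub : Some @^-1: J1 \subset Some @^-1: J2.
  by apply/fintype.subsetP => i; rewrite !inE; exact: (fintype.subsetP J12).
have memH J' : strata (blowup J) J' -> strata D (blowup_map J J').
  by case=> [/blowup_oldP[h n _]|/blowup_newP[]//]; rewrite /blowup_map (negbTE n).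
have H1 := memH _ S1; have H2 := memH _ S2.
have K12 : blowup_map J J1 \subset blowup_map J J2.
  rewrite /blowup_map; case: (boolP (None \in J1)) => n1.
    by rewrite (fintype.subsetP J12 _ n1) finset.setUS.
  by case: ifP => // _; apply: fintype.subset_trans sub (finset.subsetUr _ _).
have E := polyhedron_restr H1 H2 K12.
rewrite /P' /transform_polyhedron; case: (boolP (None \in J2)) => n2; last first.
  have n1 : None \notin J1 by apply: contra n2; exact: (fintype.subsetP J12).
  move=> _; rewrite (negbTE n1) E !image_comp; apply: eq_imagel => x _ /=.
  apply/ffunP => -[i|]; rewrite !ffunE /blowup_map ?(negbTE n1)//= ?inE//.
have nw : [set s - e_inf R _ | s in newton J2 (lambda J J2 @` polyhedron D (blowup_map J J2))]
        = newton J2 [set s - e_inf R _ | s in lambda J J2 @` polyhedron D (blowup_map J J2)].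
  exact: translate_newton.
rewrite nw restr_newton//.
case: (boolP (None \in J1)) => n1.
  move=> _; rewrite translate_newton; congr newton.
  rewrite E !image_comp; apply: eq_imagel => x _ /=.
  apply/ffunP => o; rewrite !ffunE.
  case: ifP => oJ1; last by case: o oJ1 => [i _|]; rewrite ?subr0// n1.
  rewrite (fintype.subsetP J12 _ oJ1); congr (_ - _).
  case: o oJ1 => [i|] oJ1.
    by rewrite ffunE /blowup_map n1 !inE oJ1 orbT.
  apply: eq_bigr => j jJ; rewrite ffunE.
  by rewrite /blowup_map n1 inE jJ.
move=> [_ [A AL PE]]; rewrite PE -(newton_idem J1 A) -PE E; congr newton.
rewrite !image_comp; apply: eq_imagel => x _ /=.
apply/ffunP => -[i|]; rewrite !ffunE /blowup_map ?(negbTE n1)//= inE.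
by case: ifP => // /(fintype.subsetP J12) ->; rewrite subr0.
Qed.

Definition char_transform : polyhedra_system R :=
  @PolyhedraSystem R (blowup J) (denom D) P' (denom_gt0 D)
    transform_polyhedronP transform_polyhedron_restr.

End CharTransformSystem.

Inductive transforms_to (R : realType) (D : polyhedra_system R) :
    polyhedra_system R -> Prop :=
| transforms_refl : transforms_to D D
| transforms_step (E : polyhedra_system R) (J : {set ground E}) (SJ : Sing E J) :
    transforms_to D E -> transforms_to D (char_transform SJ).

Definition has_reduction (R : realType) (D : polyhedra_system R) : Prop :=
  exists2 D', transforms_to D D' & ~ singular D'.

Section Consistency.
Variables (R : realType) (D : polyhedra_system R).

Definition red_strata (C : set {set ground D}) : set {set ground D} :=
  [set K : {set ground D} | exists2 J, C J & K \subset J].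

Lemma red_open C : open (red_strata C).
Proof.
apply/zariski_openE => J K [L CL JL] KJ; exists L => //; exact: fintype.subset_trans JL.
Qed.

Lemma red_sub C : C `<=` strata D -> red_strata C `<=` strata D.
Proof.
move=> CH K [J /CH HJ KJ]; exact: (@strata_open D J K HJ KJ).
Qed.

(* Used for C closed in strata D, such as a connected component of Sing D. *)
Definition Red C (CH : C `<=` strata D) : polyhedra_system R :=
  @PolyhedraSystem R (SupportFabric (@red_open C)) (denom D) (polyhedron D)
    (denom_gt0 D) (fun J CJ => polyhedronP (red_sub CH CJ))
    (fun J1 J2 C1 C2 => polyhedron_restr (red_sub CH C1) (red_sub CH C2)).

Definition max_contact (T : {set ground D}) : Prop :=
  [/\ strata D T, T != finset.set0 &
      forall J, Sing D J -> T \subset tangent J (polyhedron D J)].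

Definition Sing_component (J : {set ground D}) : set {set ground D} :=
  connected_component (Sing D) J.

Lemma Sing_component_strata J : Sing_component J `<=` strata D.
Proof. exact: subset_trans (@connected_component_sub _ _ _) (@Sing_strata _ D). Qed.

End Consistency.

(* Every connected component of Sing D is Sing_component J for some J in Sing D. *)
Definition consistent (R : realType) (D : polyhedra_system R) : Prop :=
  ~ singular D \/
  (special D /\ forall J, Sing D J ->
     exists T, max_contact (D := Red (@Sing_component_strata R D J)) T).

(* Main.v *)
(* Restrict D to its strata of size < n, reduce the singularities of this
   restriction, and perform the same blow-ups on D. The singular strata left in
   the resulting system D' lie over strata K of D of size n. These K are maximal,
   so the fibres over them are clopen in the singular locus of D', and a connected
   component of the latter lies over a single K. An index of the strict tangent
   space at K survives in the strict tangent space of every singular stratum over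
   K, hence has maximal contact along the whole component. *)
Require Import Defs.
From mathcomp Require Import all_boot all_order all_algebra.
From mathcomp Require Import reals.
From mathcomp Require Import boolp classical_sets topology.

Set Implicit Arguments.
Unset Strict Implicit.
Unset Printing Implicit Defensive.

Import Order.TTheory GRing.Theory Num.Theory.

Local Open Scope classical_set_scope.
Local Open Scope ring_scope.

(** * Singular strata, strict tangent indices and special systems *)

Section Singular.
Variables (R : realType) (D : polyhedra_system R).
Implicit Types J K : {set ground D}.

(** The minimum defining [delta] is attained at non-empty strata, and the value -1 rules out the
    empty one. *)
Lemma SingE J : Sing D J <->
  [/\ strata D J, J != finset.set0 &
      forall s, polyhedron D J s -> 1 <= weight J s].
Proof.
split=> [SJ|[HJ J0 w1]].
  have [HJ dJ] := SJ; split=> // [|s]; last exact: (Sing_weight SJ).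
  by apply: contraTneq dJ => ->; rewrite /delta eqxx -ltNge gtrN.
split=> //; have [[s Js <-] _] := deltaP (denom_gt0 D) (polyhedronP HJ) J0.
exact: w1.
Qed.

Lemma polyhedron_orthant J s : strata D J -> polyhedron D J s -> orthant J s.
Proof. by move=> /polyhedronP[_ [A AL ->]]; apply: newton_ge0 AL _. Qed.

Lemma ler_weight J K (s : vec R (ground D)) :
  (forall i, 0 <= s i) -> J \subset K -> weight J s <= weight K s.
Proof.
move=> s0 JK; rewrite /weight (big_setID J (A := K)) /=.
by rewrite (finset.setIidPr JK) lerDl sumr_ge0.
Qed.

Lemma Sing_up J K : Sing D J -> strata D K -> J \subset K -> Sing D K.
Proof.
move=> SJ HK JK; have [_ J0 _] := (SingE J).1 SJ; apply/SingE; split=> //.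
  by apply: contraNneq J0 => K0; rewrite -finset.subset0 -K0.
move=> s Ks; apply: le_trans (Sing_weight SJ HK JK Ks) _.
by apply: ler_weight => //; case: (polyhedron_orthant HK Ks).
Qed.

Lemma delta_eq1 J s : Sing D J -> polyhedron D J s -> weight J s = 1 ->
  delta J (polyhedron D J) = 1.
Proof.
move=> SJ Js sw; have [HJ J0 w1] := (SingE J).1 SJ.
have [_ /(_ s Js)] := deltaP (denom_gt0 D) (polyhedronP HJ) J0.
by rewrite sw => d1; apply/le_anti; rewrite d1 SJ.2.
Qed.

Lemma tangent_mem J s j : strata D J -> polyhedron D J s -> weight J s = 1 ->
  s j <> 0 -> j \in tangent J (polyhedron D J).
Proof.
move=> HJ Js sw sj; rewrite inE; apply/andP; split; last by apply/asboolP; exists s.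
by apply: contrapT => /negP jJ; apply: sj; case: (polyhedron_orthant HJ Js) => _ ->.
Qed.

Lemma delta_le_system J : strata D J ->
  delta J (polyhedron D J) <= delta_system D.
Proof. by move=> HJ; apply: le_bigmax_cond; rewrite inE. Qed.

(** Speciality caps the least weight at 1, so some point has weight exactly 1 and therefore a
    non-zero coordinate. *)
Lemma special_tangent J : special D -> Sing D J ->
  exists j, j \in tangent J (polyhedron D J).
Proof.
move=> spD SJ; have [HJ J0 w1] := (SingE J).1 SJ.
have [[s Js sw] _] := deltaP (denom_gt0 D) (polyhedronP HJ) J0.
have {}sw : weight J s = 1.
  by apply/le_anti; rewrite w1// sw andbT -spD; exact: delta_le_system.
have /existsP[j sj] : [exists j, s j != 0].
  apply: contraPT isT => /existsPn s0; have /eqP := sw.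
  rewrite /weight big1 => [|j _]; last by apply/eqP; rewrite -[_ == _]negbK s0.
  by rewrite eq_sym oner_eq0.
by exists j; apply: (tangent_mem HJ Js sw); exact/eqP.
Qed.

(** A strict tangent index comes with a point of weight 1, so [delta] is 1 on the singular locus and
    below 1 elsewhere. *)
Lemma special_of_tangent : singular D ->
  (forall J, Sing D J -> exists j, j \in tangent J (polyhedron D J)) ->
  special D.
Proof.
move=> [J SJ] h.
have d1 K : Sing D K -> delta K (polyhedron D K) = 1.
  move=> SK; have [j] := h _ SK.
  by rewrite inE => /andP[_ /asboolP[s [Ks sw _]]]; exact: delta_eq1 SK Ks sw.
apply/le_anti/andP; split; last by rewrite -(d1 _ SJ); apply: delta_le_system SJ.1.
apply: bigmax_le => [|K]; first by rewrite (le_trans _ ler01)// oppr_le0.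
rewrite inE => HK; case: (leP 1 (delta K (polyhedron D K))) => [dK|/ltW//].
by rewrite d1.
Qed.

End Singular.

(** * Restriction to an open set of strata, and its blow-ups *)

Section Restriction.
Variables (R : realType) (D : polyhedra_system R).

(** The ground set and the polyhedra stay those of [D], so one centre serves both systems. *)
Definition restrict (U : set {set ground D}) (oU : open U) (UD : U `<=` strata D) :
    polyhedra_system R :=
  @PolyhedraSystem R (SupportFabric oU) (denom D) (polyhedron D)
    (denom_gt0 D) (fun J UJ => polyhedronP (UD J UJ))
    (fun J1 J2 U1 U2 => polyhedron_restr (UD J1 U1) (UD J2 U2)).

Lemma blowup_stratumP (H : set {set ground D}) J J' :
  open H -> blowup_strata H J J' <->
  H (blowup_map J J') /\ ~ (J \subset Some @^-1: J').
Proof.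
move=> oH; rewrite /blowup_strata; split.
  by case=> [/blowup_oldP|/blowup_newP] [h n s]; rewrite /blowup_map ?(negbTE n)// in h *.
case: (boolP (None \in J')) => n [h s]; [right; exact/blowup_newP|left].
by apply/blowup_oldP; rewrite /blowup_map (negbTE n) in h.
Qed.

Lemma blowup_strataS (U : set {set ground D}) J :
  open U -> U `<=` strata D -> blowup_strata U J `<=` strata (blowup J).
Proof.
move=> oU UD J' /(blowup_stratumP _ _ oU)[UJ' JJ'].
apply/blowup_stratumP; first exact: strata_open.
by split=> //; exact: UD.
Qed.

End Restriction.

(** The data agree by computation; only the proofs stored in the records differ. *)
Lemma char_transform_restrict (R : realType) (D : polyhedra_system R)
    (U : set {set ground D}) (oU : open U) (UD : U `<=` strata D) J
    (SU : Sing (restrict oU UD) J) (SJ : Sing D J) :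
  char_transform SU =
  @restrict R (char_transform SJ) _ (blowup_open (J := J) oU) (blowup_strataS oU UD).
Proof.
by rewrite /char_transform /restrict; congr PolyhedraSystem; exact: Prop_irrelevance.
Qed.

Lemma blowup_mapS (I : finType) (J : {set I}) (J1 J2 : {set option I}) :
  J1 \subset J2 -> blowup_map J J1 \subset blowup_map J J2.
Proof.
move=> J12; have sub : Some @^-1: J1 \subset Some @^-1: J2.
  by apply/fintype.subsetP => i; rewrite !inE; exact: (fintype.subsetP J12).
rewrite /blowup_map; case: (boolP (None \in J1)) => n1.
  by rewrite (fintype.subsetP J12 _ n1) finset.setUS.
by case: ifP => // _; apply: fintype.subset_trans sub (finset.subsetUr _ _).
Qed.

Lemma weight_option (R : realType) (I : finType) (J : {set option I})
    (s : vec R (option I)) :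
  weight J s = (if None \in J then s None else 0) +
    weight (Some @^-1: J) [ffun i => s (Some i)].
Proof.
rewrite /weight big_mkcond (bigD1 None) //=; congr (_ + _).
rewrite (reindex_omap Some id) => [|[]//]; rewrite [RHS]big_mkcond /=.
by apply: eq_big => [i|i _]; rewrite ?eqxx// inE ffunE.
Qed.

(** * Singular strata and strict tangent indices under a transform *)

Section TransformTangent.
Variables (R : realType) (D : polyhedra_system R) (J : {set ground D}).
Hypothesis SJ : Sing D J.

(** A new stratum lies over one containing the singular centre; at an old one the polyhedron is only
    copied. *)
Lemma Sing_char_transform J' :
  Sing (char_transform SJ) J' -> Sing D (blowup_map J J').
Proof.
move=> /SingE[HJ' J'0 w1].
have [HK _] := (blowup_stratumP _ _ (@strata_open D)).1 HJ'.
case: (boolP (None \in J')) => n.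
  apply: (Sing_up SJ HK); rewrite /blowup_map n; exact: finset.subsetUl.
apply/SingE; split=> //.
  apply: contraNneq J'0; rewrite /blowup_map (negbTE n).
  by rewrite -{2}(imset_preim_Some n) => ->; rewrite imset0.
move=> s Ks; have := w1 (extend0 s); rewrite weight_option (negbTE n) add0r.
rewrite /blowup_map (negbTE n) in Ks *.
have -> : [ffun i => extend0 s (Some i)] = s by apply/ffunP => i; rewrite !ffunE.
apply; rewrite /= /transform_polyhedron (negbTE n); exists s => //.
by rewrite /blowup_map (negbTE n).
Qed.

(* A point of weight 1 over a singular stratum containing the centre has no
   weight outside the centre, so the blow-up only restricts it to J'. *)
Lemma char_transform_tangent J' j : Sing (char_transform SJ) J' ->
  j \in tangent (blowup_map J J') (polyhedron D (blowup_map J J')) ->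
  Some j \in tangent J' (polyhedron (char_transform SJ) J').
Proof.
move=> SJ'; have SK := Sing_char_transform SJ'; have HK := SK.1.
have [HJ' _ w1] := (SingE J').1 SJ'.
rewrite {1}inE => /andP[_ /asboolP[s [Ks sw sj]]].
have [s0 sK] := polyhedron_orthant HK Ks.
case: (boolP (None \in J')) => n; last first.
  apply: (@tangent_mem R (char_transform SJ) J' (extend0 s)) => //.
  - by rewrite /= /transform_polyhedron (negbTE n); exists s.
  - rewrite weight_option (negbTE n) add0r -[RHS]sw /blowup_map (negbTE n).
    by congr weight; apply/ffunP => i; rewrite !ffunE.
  - by rewrite ffunE.
have JK : J \subset blowup_map J J' by rewrite /blowup_map n finset.subsetUl.
(* The singular centre carries weight at least 1, and the larger stratum [blowup_map J J'] exactly
   1. *)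
have Js : weight J s = 1.
  by apply/le_anti; rewrite (Sing_weight SJ HK JK Ks) -{1}sw ler_weight.
pose s' := lambda J J' s - e_inf R (ground D).
have Ps' : polyhedron (char_transform SJ) J' s'.
  rewrite /= /transform_polyhedron n; exists (lambda J J' s) => //.
  by apply: newton_sub; exists s.
have s'w : weight J' s' = weight (Some @^-1: J') s.
  rewrite weight_option n !ffunE n -/(weight J s) Js subrr add0r.
  by apply: eq_bigr => i iJ'; rewrite !ffunE subr0; rewrite inE in iJ'; rewrite iJ'.
have subK : Some @^-1: J' \subset blowup_map J J'.
  by rewrite /blowup_map n finset.subsetUr.
(* Losing [j], where [s] is positive, would leave [s'] with weight below 1 at a singular stratum. *)
have jJ' : Some j \in J'.
  have := w1 _ Ps'; rewrite s'w; apply: contraTT => jJ'.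
  have jK : j \in blowup_map J J'.
    by apply: contraT => /sK.
  rewrite -ltNge -sw /weight (big_setD1 j jK) /=.
  apply: (@le_lt_trans _ _ (weight (blowup_map J J' :\ j) s)).
    by apply: ler_weight => //; rewrite subsetD1 subK inE.
  by rewrite ltrDr lt_def s0 andbT; apply/eqP.
apply: (@tangent_mem R (char_transform SJ) J' s') => //.
  by apply/le_anti; rewrite w1// s'w -{1}sw ler_weight.
by rewrite !ffunE jJ' subr0.
Qed.

End TransformTangent.

(** * Lifting a sequence of transforms from a restriction *)

(* p sends a stratum of the transform to the stratum of D it lies over, f sends
   an index of D to its copy, and t picks a strict tangent index at each
   singular stratum of D. *)
Record tracks (R : realType) (D D' : polyhedra_system R)
    (t : {set ground D} -> ground D) (U : set {set ground D})
    (U' : set {set ground D'}) (p : {set ground D'} -> {set ground D})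
    (f : ground D -> ground D') : Prop := {
  tracks_strata : forall J, strata D' J -> strata D (p J);
  tracks_sub : forall J K : {set ground D'}, J \subset K -> p J \subset p K;
  tracks_over : forall J, strata D' J -> U (p J) -> U' J;
  tracks_tangent : forall J, Sing D' J ->
    f (t (p J)) \in tangent J (polyhedron D' J) }.

(** By induction on the sequence: a centre singular in the restriction is singular in the whole
    system, so the same blow-up can be made there. *)
Lemma transforms_to_lift (R : realType) (D : polyhedra_system R)
    (U : set {set ground D}) (oU : open U) (UD : U `<=` strata D) t E :
  (forall J, Sing D J -> t J \in tangent J (polyhedron D J)) ->
  transforms_to (restrict oU UD) E ->
  exists (D' : polyhedra_system R) (U' : set {set ground D'}) (oU' : open U')
    (UD' : U' `<=` strata D') p f,
    [/\ E = restrict oU' UD', transforms_to D D' & tracks t U U' p f].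
Proof.
move=> tT; elim=> [|{}E J SE _ [D' [U' [oU' [UD' [p [f [EE DD' tr]]]]]]]].
  exists D, U, oU, UD, id, id; split; [by []|exact: transforms_refl|by split].
subst E.
have SJ : Sing D' J by case: SE => /UD' HJ dJ; split.
exists (char_transform SJ), (blowup_strata U' J), (blowup_open (J := J) oU'),
  (blowup_strataS oU' UD'), (p \o blowup_map J), (Some \o f).
split; [exact: char_transform_restrict|exact: transforms_step|].
have strP := blowup_stratumP _ _ (@strata_open D').
split=> [K /strP[HK _]|K L KL|K /strP[HK nK] UK|K SK] /=.
- exact: tracks_strata tr _ HK.
- by apply: (tracks_sub tr); exact: blowup_mapS.
- by apply/blowup_stratumP => //; split=> //; exact: tracks_over tr _ HK UK.
- by apply: char_transform_tangent => //; apply: (tracks_tangent tr);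
    exact: Sing_char_transform SK.
Qed.

(** * Connected components and maximal contact *)

Section Component.
Variables (I I' : finType) (S : set {set I'}) (p : {set I'} -> {set I}).
Hypothesis pS : forall J K : {set I'}, S J -> S K -> J \subset K -> p J = p K.

(** By [pS], a fibre of [p] in [S] is stable under smaller and larger elements of [S], hence clopen
    in [S]; a connected set meets only one. *)
Lemma component_fiber J K : connected_component S J K -> p K = p J.
Proof.
move=> [A [AJ AS cA] AK].
have SA L : A L -> S L by move/AS.
suff AE : [set L | A L /\ p L = p J] = A by move: AK; rewrite -AE => -[].
apply: cA; first by exists J.
  (* The downward closure of the fibre is open and meets [A] in the fibre alone. *)
  exists [set L : {set I'} | exists2 M, A M /\ p M = p J & L \subset M].
    by apply/zariski_openE => L M [N AN LN] ML; exists N => //; exact: fintype.subset_trans LN.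
  apply/seteqP; split=> L /= [AL].
    by move=> pL; split=> //; exists L.
  by move=> [M [AM <-] LM]; split=> //; apply: pS => //; exact: SA.
(* The upward closure does the same for closedness. *)
exists [set L : {set I'} | exists2 M, A M /\ p M = p J & M \subset L].
  by apply/zariski_closedE => L M [N AN NL] LM; exists N => //; exact: fintype.subset_trans LM.
apply/seteqP; split=> L /= [AL].
  by move=> pL; split=> //; exists L.
by move=> [M [AM <-] ML]; split=> //; apply/esym/pS => //; exact: SA.
Qed.

End Component.

(** The index [t (p J)] is constant along a component, so its singleton has maximal contact
    there. *)
Lemma consistent_of_fibers (R : realType) (D' : polyhedra_system R) (I : finType)
    (p : {set ground D'} -> {set I}) (t : {set I} -> ground D') :
  (forall J K : {set ground D'}, Sing D' J -> Sing D' K -> J \subset K -> p J = p K) ->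
  (forall J, Sing D' J -> t (p J) \in tangent J (polyhedron D' J)) ->
  consistent D'.
Proof.
move=> pS tT; have [sD|] := pselect (singular D'); last by left.
right; split; first by apply: special_of_tangent => // J /tT; exists (t (p J)).
move=> J SJ; exists [set t (p J)]%SET; split.
- exists J; first exact: connected_component_refl.
  by rewrite finset.sub1set; have := tT _ SJ; rewrite inE => /andP[].
- by rewrite -card_gt0 cards1.
(* A singular stratum of the reduction lies below some [L] of the component, and [pS] puts it in the
   same fibre. *)
move=> K [[L CL KL] dK]; rewrite finset.sub1set.
have SL : Sing D' L := connected_component_sub CL.
have SK : Sing D' K by split=> //; exact: (@strata_open D' L K SL.1 KL).
by rewrite -(component_fiber pS CL) -(pS _ _ SK SL KL); exact: tT.
Qed.

Theorem proposition10 (R : realType) (n : nat) (n_ge1 : (1 <= n)%N)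
  (reduction_lower : forall E : polyhedra_system R,
    (fabric_dim E <= n - 1)%N -> has_reduction E)
  (D : polyhedra_system R) (dimD : fabric_dim D = n) (specialD : special D) :
  exists2 D' : polyhedra_system R, transforms_to D D' & consistent D'.
Proof.
have [sD|nsD] := pselect (singular D); last first.
  by exists D; [exact: transforms_refl|left].
(* A default value for [t] at non-singular strata. *)
have [i0 _] : exists i : ground D, True.
  by have [J /(special_tangent specialD)[j _]] := sD; exists j.
have /choice[t tT] : forall J, exists j, Sing D J -> j \in tangent J (polyhedron D J).
  move=> J; have [/(special_tangent specialD)[j jT]|nSJ] := pselect (Sing D J).
    by exists j.
  by exists i0.
(* These strata give a restriction of dimension at most [n - 1], which has a reduction by
   hypothesis. *)
pose U : set {set ground D} := [set J | strata D J /\ (#|J| <= n - 1)%N].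
have oU : open U.
  apply/zariski_openE => J K [HJ cJ] KJ; split; first exact: (@strata_open D J K HJ KJ).
  exact: leq_trans (subset_leq_card KJ) cJ.
have UD : U `<=` strata D by move=> J [].
have [E] : has_reduction (restrict oU UD).
  by apply: reduction_lower; apply/bigmax_leqP => J; rewrite inE => -[].
move=> /(transforms_to_lift tT)[D' [U' [oU' [UD' [p [f [-> DD' tr]]]]]]] nsE.
exists D' => //; apply: (@consistent_of_fibers _ _ _ p (f \o t)); last first.
  exact: tracks_tangent tr.
have cardp J : Sing D' J -> #|p J| = n.
  move=> SJ; have HpJ := tracks_strata tr SJ.1.
  apply/eqP; rewrite eqn_leq -{1}dimD; apply/andP; split.
    by apply: (@leq_bigmax_cond _ _ (fun J : {set ground D} => #|J|)); rewrite inE.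
  (* A smaller [p J] would lie in [U], making [J] singular in the reduced restriction. *)
  rewrite leqNgt; apply/negP => lt; apply: nsE; exists J; split; last exact: SJ.2.
  by apply: (tracks_over tr SJ.1); split=> //; rewrite leq_subRL// add1n.
move=> J K SJ SK /(tracks_sub tr) JK; apply/eqP.
by rewrite eqEcard JK !cardp ?leqnn.
Qed.
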